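(* Let $K:\mathbb R^2\setminus\Delta\to\mathbb C$ be a compact Calderón–Zygmund kernel such that $\lim_{|t-x|\to\infty}K(t,x)=0$. Then there exist admissible functions $\tilde L,\tilde S,\tilde D$ such that, with $\tilde F(t,x)=\tilde L(|t-x|)\tilde S(|t-x|)\tilde D(|t+x|)$, $$|K(t,x)|\le \frac{1}{|t-x|}\,\tilde F(t,x)\qquad\text{for all }(t,x)\in\mathbb R^2\setminus\Delta .$$
   Context: $\Delta$ is the diagonal of $\mathbb R^2$. Three bounded functions $L,S,D:[0,\infty)\to[0,\infty)$ are admissible if $\lim_{x\to\infty}L(x)=\lim_{x\to0}S(x)=\lim_{x\to\infty}D(x)=0$. A function $K:\mathbb R^2\setminus\Delta\to\mathbb C$ is a compact Calderón–Zygmund kernel if it is bounded on compact subsets of $\mathbb R^2\setminus\Delta$ and, for some $0<\delta\le1$, $C>0$ and admissible $L,S,D$, $|K(t,x)-K(t',x')|\le C\frac{(|t-t'|+|x-x'|)^\delta}{|t-x|^{1+\delta}}F(t,x)$ with $F(t,x)=L(|t-x|)S(|t-x|)D(|t+x|)$, whenever $2(|t-t'|+|x-x'|)<|t-x|$. *)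

(* Defs.v *)
From mathcomp Require Import all_boot all_order all_algebra.
From mathcomp Require Import complex.
From mathcomp Require Import all_classical all_reals all_analysis.

Set Implicit Arguments.
Unset Strict Implicit.
Unset Printing Implicit Defensive.

Import Order.TTheory GRing.Theory Num.Theory.
Import numFieldNormedType.Exports.

Local Open Scope classical_set_scope.
Local Open Scope ring_scope.
Local Open Scope complex_scope.

(* Functions on [0, +oo[ are total functions R -> R, and functions on the
   complement of the diagonal are total functions on R * R; every condition
   below only involves their values on the intended domain. *)
Definition bounded_nonneg (R : realType) (f : R -> R) : Prop :=
  (forall x, 0 <= x -> 0 <= f x) /\ [bounded f x | x in `[0, +oo[%classic].

Definition admissible (R : realType) (L S D : R -> R) : Prop :=
  [/\ bounded_nonneg L, bounded_nonneg S & bounded_nonneg D] /\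
  [/\ L x @[x --> +oo] --> (0 : R),
      S x @[x --> 0^'+] --> (0 : R) &
      D x @[x --> +oo] --> (0 : R)].

Definition admissible_weight (R : realType) (L S D : R -> R) (p : R * R) : R :=
  L `|p.1 - p.2| * S `|p.1 - p.2| * D `|p.1 + p.2|.

(* The norm of R[i] takes its values in R[i] itself, hence the cast %:C of the
   real right-hand side. *)
Definition compact_CZ_estimate (R : realType) (K : R * R -> R[i])
    (delta C : R) (F : R * R -> R) : Prop :=
  forall t x t' x' : R,
    2 * (`|t - t'| + `|x - x'|) < `|t - x| ->
    `|K (t, x) - K (t', x')| <=
      (C * ((`|t - t'| + `|x - x'|) `^ delta / `|t - x| `^ (1 + delta))
         * F (t, x))%:C.

Definition compact_CZ_kernel (R : realType) (K : R * R -> R[i]) : Prop :=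
  (forall A : set (R * R), compact A -> A `<=` ~` diagonal ->
     exists M : R, forall p, A p -> `|K p| <= M%:C) /\
  (exists delta C : R, exists L S D : R -> R,
     [/\ 0 < delta <= 1, 0 < C, admissible L S D &
         compact_CZ_estimate K delta C (admissible_weight L S D)]).

(* The filter describing |t - x| --> oo, with no constraint on t + x. *)
Definition far_from_diagonal (R : realType) : set_system (R * R) :=
  filter_from setT (fun M : R => [set p | M < `|p.1 - p.2|]).

(* Main.v *)
(** Along the points (t_n, x_n) with t_n - x_n = lambda^n (t - x) and
t_n + x_n = t + x, the kernel tends to 0, so |K(t, x)| is at most the sum of
its increments.  With r = |t - x| and G = L S, the n-th increment is at most
C lambda^-n r^-1 G(lambda^n r) D(|t + x|).  The supremum H(r) over n of
lambda^(-n/2) G(lambda^n r) inherits from G boundedness and the limit 0 at 0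
and at infinity, and the remaining factors lambda^(-n/2) are summable.  Hence
r |K(t, x)| is bounded by a multiple of H(r) D(|t + x|), and each of the two
new functions L, S can be taken to be the square root of that multiple of H. *)
Require Import Defs.
From mathcomp Require Import all_boot all_order all_algebra.
From mathcomp Require Import complex.
From mathcomp Require Import all_classical all_reals all_analysis.
From mathcomp Require Import ring lra.

Import Order.TTheory GRing.Theory Num.Theory.
Import numFieldNormedType.Exports.

Local Open Scope classical_set_scope.
Local Open Scope ring_scope.
Local Open Scope complex_scope.

(** * Bounded nonnegative functions on the half-line *)

Lemma bounded_nonnegP (R : realType) (f : R -> R) :
  bounded_nonneg f <->
  (forall x, 0 <= x -> 0 <= f x) /\
  (exists M, forall x, 0 <= x -> f x <= M).
Proof.
split=> -[f0 fb]; split=> //.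
  have [M [_ Mf]] := fb.
  exists (M + 1) => x x0; rewrite (le_trans (ler_norm _))//.
  by apply: Mf; [rewrite ltrDl | rewrite /= in_itv/= x0].
have [M fM] := fb; exists M; split; first exact: num_real.
move=> y My x /=; rewrite in_itv/= andbT => x0.
by rewrite ger0_norm ?f0// (le_trans (fM _ x0))// ltW.
Qed.

Lemma bounded_nonnegM (R : realType) (f g : R -> R) :
  bounded_nonneg f -> bounded_nonneg g -> bounded_nonneg (f \* g).
Proof.
move=> /bounded_nonnegP[f0 [A fA]] /bounded_nonnegP[g0 [B gB]].
apply/bounded_nonnegP; split=> [x x0|]; first by rewrite mulr_ge0 ?f0 ?g0.
by exists (A * B) => x x0; rewrite ler_pM ?f0 ?g0 ?fA ?gB.
Qed.

(** The bound on [g] is available on the half-line only, so [F] has to concentrate there. *)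
Lemma cvg0_mulr_bounded_nonneg (R : realType) (F : set_system R)
    (FF : Filter F) (f g : R -> R) :
  (\forall x \near F, 0 <= x) -> bounded_nonneg g ->
  f x @[x --> F] --> (0 : R) -> (f \* g) x @[x --> F] --> (0 : R).
Proof.
move=> F0 /bounded_nonnegP[g0 [M gM]] f0; apply/cvgr0Pnorm_le => e e0.
(* [M] may be 0, so the divisor is [M + 1]. *)
have M1 : 0 < M + 1 by rewrite ltr_wpDl// (le_trans (g0 0 _) (gM 0 _)).
apply: filterS2 F0 (cvgr0_norm_le f f0 (e / (M + 1)) (divr_gt0 e0 M1)).
move=> x x0 fx; rewrite /= normrM (ger0_norm (g0 _ x0)).
rewrite -[e](divfK (lt0r_neq0 M1)) ler_pM ?g0//.
by rewrite (le_trans (gM _ x0))// lerDl.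
Qed.

Lemma pinfty_ge0 (R : realType) : \forall x \near (+oo : set_system R), 0 <= x.
Proof.
by near do apply: ltW; exact: nbhs_pinfty_gt.
Unshelve. all: by end_near. Qed.

Lemma right_ge0 (R : realType) : \forall x \near (0 : R)^'+, 0 <= x.
Proof. exact: nbhs_right_ge. Qed.

(** * The weighted supremum over dilations *)

(** This is H from the overview, with [q] in the role of lambda^(-1/2): the dilation uses [q] twice
    per step and the weight once. *)
Definition geometric_sup {R : realType} (q : R) (G : R -> R) (r : R) : R :=
  sup (range (fun n => q ^+ n * G (r / q ^+ n.*2))).

Section GeometricSup.
Variables (R : realType) (q : R) (G : R -> R).
Hypotheses (q0 : 0 < q) (q1 : q < 1) (Gbn : bounded_nonneg G).

Let expq0 n : 0 <= q ^+ n. Proof. by rewrite exprn_ge0// ltW. Qed.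
Let expq1 n : q ^+ n <= 1. Proof. by rewrite exprn_ile1// ltW. Qed.
Let dilate_ge0 r n : 0 <= r -> 0 <= r / q ^+ n.
Proof. by move=> r0; rewrite divr_ge0. Qed.

Lemma geometric_sup_ub r n :
  0 <= r -> q ^+ n * G (r / q ^+ n.*2) <= geometric_sup q G r.
Proof.
move=> r0; apply: ub_le_sup; last by exists n.
have /bounded_nonnegP[G0 [M GM]] := Gbn.
by exists M => _ [m _ <-]; rewrite -[M]mul1r ler_pM ?G0 ?GM ?dilate_ge0.
Qed.

Lemma geometric_sup_le r M :
  (forall n, q ^+ n * G (r / q ^+ n.*2) <= M) -> geometric_sup q G r <= M.
Proof.
move=> hM; apply: ge_sup => [|_ [n _ <-]//].
by exists (q ^+ 0 * G (r / q ^+ 0)), 0%N.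
Qed.

Lemma bounded_nonneg_geometric_sup : bounded_nonneg (geometric_sup q G).
Proof.
have /bounded_nonnegP[G0 [M GM]] := Gbn.
apply/bounded_nonnegP; split=> [r r0|].
  apply: le_trans (@geometric_sup_ub r 0 r0).
  by rewrite mulr_ge0 ?G0 ?dilate_ge0.
exists M => r r0; apply: geometric_sup_le => n.
by rewrite -[M]mul1r ler_pM ?G0 ?GM ?dilate_ge0.
Qed.

(** Dividing by a power of [q < 1] only moves the argument outward, so one threshold for [G] serves
    all [n]. *)
Lemma geometric_sup_cvg_pinfty :
  G r @[r --> +oo] --> (0 : R) -> geometric_sup q G r @[r --> +oo] --> (0 : R).
Proof.
have /bounded_nonnegP[G0 [M GM]] := Gbn.
have /bounded_nonnegP[H0 _] := bounded_nonneg_geometric_sup.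
move=> Goo; apply/cvgr0Pnorm_le => e e0.
have [A [_ GA]] := cvgr0_norm_le G Goo e e0.
exists (Num.max 0 A); split; first exact: num_real.
move=> r; rewrite /= gt_max => /andP[r0 rA].
rewrite ger0_norm ?H0 ?(ltW r0)//; apply: geometric_sup_le => n.
have /GA Ge : A < r / q ^+ n.*2.
  by rewrite (lt_le_trans rA)// ler_pdivlMr ?exprn_gt0// ler_piMr// ltW.
rewrite -[e]mul1r ler_pM ?G0 ?dilate_ge0 ?(ltW r0)//.
exact: le_trans (ler_norm _) Ge.
Qed.

(** A dilation can carry a small [r] far from 0. As long as it does not, [G] is small; once it does,
    [n] is so large that the weight is small against the bound of [G]. *)
Lemma geometric_sup_cvg_right0 :
  G r @[r --> 0^'+] --> (0 : R) ->
  geometric_sup q G r @[r --> 0^'+] --> (0 : R).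
Proof.
have /bounded_nonnegP[G0 [M GM]] := Gbn.
have /bounded_nonnegP[H0 _] := bounded_nonneg_geometric_sup.
move=> Goo; apply/cvgr0Pnorm_le => e e0.
have [a /= a0 Ga] := cvgr0_norm_le G Goo e e0.
have M1 : 0 < M + 1 by rewrite ltr_wpDl// (le_trans (G0 0 _) (GM 0 _)).
pose e' := e / (M + 1); have e'0 : 0 < e' by rewrite divr_gt0.
near=> r.
have r0 : 0 < r by [].
rewrite ger0_norm ?H0 ?(ltW r0)//; apply: geometric_sup_le => n.
have [rn|rn] := ltP (r / q ^+ n.*2) a.
  rewrite -[e]mul1r ler_pM ?G0 ?dilate_ge0 ?(ltW r0)//.
  apply: le_trans (ler_norm _) _.
  apply: Ga; last by rewrite divr_gt0// exprn_gt0.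
  by rewrite /ball_ /= sub0r normrN ger0_norm ?dilate_ge0 ?ltW.
(* q^(2n) <= r / a, so the weight q^n itself is small *)
have qe : q ^+ n <= e'.
  rewrite -(@ler_pXn2r _ 2) ?nnegrE ?(ltW e'0)// -exprM muln2.
  have : r <= a * e' ^+ 2.
    by near: r; apply: nbhs_right_le; rewrite mulr_gt0// exprn_gt0.
  move: rn; rewrite ler_pdivlMr ?exprn_gt0// => h1 h2.
  by rewrite -(ler_pM2l a0) (le_trans h1).
rewrite -[e](divfK (lt0r_neq0 M1)) ler_pM ?G0 ?dilate_ge0 ?(ltW r0)//.
by rewrite (le_trans (GM _ _)) ?dilate_ge0 ?(ltW r0)// lerDl.
Unshelve. all: by end_near. Qed.

End GeometricSup.

(** * Telescoping and the size estimate *)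

Lemma telescope_geometric (R : realFieldType) (q B : R) (a : nat -> R) :
  0 <= B -> 0 < q < 1 -> (forall n, a n <= a n.+1 + q ^+ n * B) ->
  forall N, a 0%N <= a N + B / (1 - q).
Proof.
move=> B0 /andP[q0 q1] step N.
have d0 : 0 < 1 - q by rewrite subr_gt0.
(* The exact partial sum of the geometric series makes the induction close. *)
have : a 0%N <= a N + B / (1 - q) * (1 - q ^+ N).
  elim: N => [|N IH]; first by rewrite subrr mulr0 addr0.
  apply: le_trans IH _; rewrite -lerBrDr -addrA -mulrBr.
  apply: le_trans (step N) _; rewrite lerD2l.
  rewrite le_eqVlt; apply/orP; left; apply/eqP.
  by rewrite exprS; field; rewrite gt_eqF.
move/le_trans; apply; rewrite lerD2l ler_piMr//.
  by rewrite divr_ge0// ltW.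
by rewrite gerBl exprn_ge0// ltW.
Qed.

(** Lets the estimates run in [R], although the norm lives in [R[i]]. *)
Lemma normc_real (R : rcfType) (z : R[i]) : `|z| = (complex.Re `|z|)%:C.
Proof. by rewrite RRe_real// normr_real. Qed.

Lemma far_from_diagonal_cvg0 (R : realType) (K : R * R -> R[i]) (e : R) :
  (K p : R[i]^o) @[p --> @far_from_diagonal R] --> (0 : R[i]^o) -> 0 < e ->
  exists M, forall p, M < `|p.1 - p.2| -> complex.Re `|K p| <= e.
Proof.
move=> K0 e0.
have : nbhs (0 : R[i]^o) [set z : R[i]^o | `|z| < e%:C].
  by apply: (@nbhs0_lt _ R[i]^o); rewrite ltcR.
move/K0 => -[M _ MK]; exists M => p /MK /=.
by rewrite normc_real ltcR => /ltW.
Qed.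

(** With h the displacement and r the distance to the diagonal, h <= r gives h^delta <= r^delta, so
    the smoothness quotient is at most 1/r and [delta] disappears. *)
Lemma CZ_increment (R : realType) (K : R * R -> R[i]) (delta C : R)
    (F : R * R -> R) (t x t' x' : R) :
  0 <= delta -> 0 <= C * F (t, x) -> compact_CZ_estimate K delta C F ->
  2 * (`|t - t'| + `|x - x'|) < `|t - x| ->
  complex.Re `|K (t, x)| <=
    complex.Re `|K (t', x')| + `|t - x|^-1 * (C * F (t, x)).
Proof.
move=> d0 CF0 KF near; have := KF _ _ _ _ near.
rewrite -lerBlDl => /(le_trans (lerB_dist _ _)).
rewrite 2!normc_real -rmorphB lecR => /le_trans; apply.
set h := `|t - t'| + _ in near *; set r := `|t - x| in near *.
have h0 : 0 <= h by rewrite addr_ge0.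
have r0 : 0 < r by lra.
rewrite mulrAC [leRHS]mulrC ler_wpM2l//.
rewrite powRD ?(gt_eqF r0) ?implybT// powRr1 ?(ltW r0)// invfM mulrCA.
rewrite ler_piMr ?invr_ge0 ?(ltW r0)// ler_pdivrMr ?powR_gt0// mul1r.
by apply: ge0_ler_powR => //; rewrite ?nnegrE ?(ltW r0)//; lra.
Qed.

(* The ratio lambda = q^-2 of consecutive distances to the diagonal has to be
   below 3/2, because the estimate only covers increments smaller than half of
   the distance; q = 5/6 gives 36/25. *)
Lemma compact_CZ_bound (R : realType) (K : R * R -> R[i]) (delta C : R)
    (L S D : R -> R) :
  0 <= delta -> 0 <= C -> bounded_nonneg L -> bounded_nonneg S ->
  bounded_nonneg D ->
  compact_CZ_estimate K delta C (admissible_weight L S D) ->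
  (K p : R[i]^o) @[p --> @far_from_diagonal R] --> (0 : R[i]^o) ->
  forall t x, t != x ->
  complex.Re `|K (t, x)| <= `|t - x|^-1 *
    (6 * C * geometric_sup (5 / 6) (L \* S) `|t - x| * D `|t + x|).
Proof.
move=> d0 C0 Lb Sb Db KF K0 t x tx.
have /bounded_nonnegP[D0 _] := Db.
have LSb := bounded_nonnegM _ _ _ Lb Sb.
have /bounded_nonnegP[LS0 _] := LSb.
set q : R := 5 / 6; have q0 : 0 < q by rewrite /q; lra.
have q1 : q < 1 by rewrite /q; lra.
have /bounded_nonnegP[H0 _] := bounded_nonneg_geometric_sup _ _ _ q0 q1 LSb.
set r := `|t - x|; set H := geometric_sup q _.
have r0 : 0 < r by rewrite normr_gt0 subr_eq0.
pose T n := (t + x + (t - x) / q ^+ n.*2) / 2.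
pose X n := (t + x - (t - x) / q ^+ n.*2) / 2.
have qn n : 0 < q ^+ n by rewrite exprn_gt0.
have TBX n : T n - X n = (t - x) / q ^+ n.*2 by rewrite /T /X; lra.
have TDX n : T n + X n = t + x by rewrite /T /X; lra.
have rn n : `|T n - X n| = r / q ^+ n.*2.
  by rewrite TBX normrM normfV (ger0_norm (ltW (qn _))).
have qS n : (q ^+ n.+1.*2)^-1 = 36 / 25 / q ^+ n.*2.
  by rewrite doubleS !exprS !invfM !mulrA; congr (_ * _); rewrite /q; field.
(* 11/50 is half of 36/25 - 1. Twice the total displacement is 44/50 of the distance, as the kernel
   estimate demands. *)
have hT n : T n - T n.+1 = (T n - X n) * (- (11 / 50)).
  by rewrite TBX /T qS; lra.
have hX n : X n - X n.+1 = (T n - X n) * (11 / 50).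
  by rewrite TBX /X qS; lra.
pose B := r^-1 * (C * H r * D `|t + x|).
have B0 : 0 <= B by rewrite !mulr_ge0 ?invr_ge0 ?H0 ?D0 ?(ltW r0).
pose a n := complex.Re `|K (T n, X n)|.
have step n : a n <= a n.+1 + q ^+ n * B.
  have W0 : 0 <= C * admissible_weight L S D (T n, X n).
    exact: mulr_ge0 C0 (mulr_ge0 (LS0 _ (normr_ge0 _)) (D0 _ (normr_ge0 _))).
  apply: le_trans (CZ_increment _ _ _ _ _ _ _ (T n.+1) (X n.+1) d0 W0 KF _) _.
    have c0 : 0 <= 11 / 50 :> R by lra.
    rewrite hT hX 2!(normrM (T n - X n)) normrN (ger0_norm c0).
    have : 0 < `|T n - X n| by rewrite rn divr_gt0.
    lra.
  rewrite lerD2l /admissible_weight/= TDX rn.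
  have := geometric_sup_ub _ _ _ q0 q1 LSb r n (ltW r0).
  rewrite -/(H r) /= => Hr.
  (* One factor [q ^+ n] is absorbed into [H r], the other is kept for summation. *)
  have -> : (r / q ^+ n.*2)^-1 = q ^+ n * q ^+ n / r.
    by rewrite invfM invrK mulrC -exprD addnn.
  rewrite /B; set G := L _ * S _ in Hr *.
  have -> : q ^+ n * q ^+ n / r * (C * (G * D `|t + x|)) =
    (q ^+ n * r^-1 * C * D `|t + x|) * (q ^+ n * G) by ring.
  have -> : q ^+ n * (r^-1 * (C * H r * D `|t + x|)) =
    (q ^+ n * r^-1 * C * D `|t + x|) * H r by ring.
  by rewrite ler_wpM2l// !mulr_ge0 ?D0 ?invr_ge0 ?(ltW r0) ?(ltW (qn _)).
(* The slack [e] pays for the last term of the telescoping sum, taken far from the diagonal. *)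
apply/ler_addgt0Pr => e e0.
have [M MK] := far_from_diagonal_cvg0 _ _ _ K0 e0.
have [N MN] : exists N, M < r / q ^+ N.*2.
  (* If q^N (|M| + 1) < r, then M q^(2N) <= |M| q^N < r; [M] may have any sign. *)
  have M1 : 0 < `|M| + 1 by rewrite ltr_wpDl.
  have nq1 : `|q| < 1 by rewrite ger0_norm// ltW.
  have [N _ /(_ _ (leqnn _))] :=
    cvgr0_norm_lt _ (cvg_expr nq1) (r / (`|M| + 1)) (divr_gt0 r0 M1).
  rewrite /= ger0_norm ?(ltW (qn _))// ltr_pdivlMr// => qN.
  exists N; rewrite ltr_pdivlMr//.
  apply: le_lt_trans qN; rewrite mulrC -addnn exprD -mulrA ler_pM2l//.
  apply: le_trans (_ : `|M| <= _); last by rewrite lerDl.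
  apply: le_trans (ler_norm _) _.
  by rewrite normrM (ger0_norm (ltW (qn _))) ler_piMl// exprn_ile1// ltW.
have := telescope_geometric _ _ _ a B0 _ step N; rewrite /a.
have -> : T 0%N = t by rewrite /T double0 expr0 divr1; field.
have -> : X 0%N = x by rewrite /X double0 expr0 divr1; field.
rewrite q0 q1 => /(_ isT) /le_trans; apply; rewrite addrC lerD//.
  (* The constant 6 is the sum of the geometric series of ratio 5/6. *)
  have -> : 1 - q = 6^-1 by rewrite /q; lra.
  by rewrite invrK /B le_eqVlt; apply/orP; left; apply/eqP; ring.
by apply: MK; rewrite rn.
Qed.

Theorem lemma2p4 (R : realType) (K : R * R -> R[i]) :
  compact_CZ_kernel K ->
  (K p : R[i]^o) @[p --> @far_from_diagonal R] --> (0 : R[i]^o) ->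
  exists L S D : R -> R, admissible L S D /\
    forall t x : R, ~ diagonal (t, x) ->
      `|K (t, x)| <= (`|t - x|^-1 * admissible_weight L S D (t, x))%:C.
Proof.
move=> [_ [delta [C [L [S [D [/andP[d0 _] C0 adm KF]]]]]]] K0.
have [[Lb Sb Db] [Loo S00 Doo]] := adm.
pose q : R := 5 / 6; have q0 : 0 < q by rewrite /q; lra.
have q1 : q < 1 by rewrite /q; lra.
have LSb := bounded_nonnegM _ _ _ Lb Sb.
pose H := geometric_sup q (L \* S).
have Hb : bounded_nonneg H by exact: bounded_nonneg_geometric_sup.
(* At infinity [L] supplies the decay and [S] is only bounded; at 0 the roles are exchanged. *)
have Hoo : H r @[r --> +oo] --> (0 : R).
  apply: geometric_sup_cvg_pinfty => //.
  by apply: cvg0_mulr_bounded_nonneg Sb Loo; exact: pinfty_ge0.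
have H00 : H r @[r --> 0^'+] --> (0 : R).
  apply: geometric_sup_cvg_right0 => //.
  have -> : L \* S = S \* L by apply/funext => r /=; rewrite mulrC.
  by apply: cvg0_mulr_bounded_nonneg Lb S00; exact: right_ge0.
have /bounded_nonnegP[H0 [M HM]] := Hb.
pose L' r := Num.sqrt (6 * C * H r).
have L'b : bounded_nonneg L'.
  apply/bounded_nonnegP; split=> [r r0|]; first exact: sqrtr_ge0.
  exists (Num.sqrt (6 * C * M)) => r r0.
  by rewrite ler_wsqrtr// ler_wpM2l ?HM// mulr_ge0// ltW.
have L'0 (F : set_system R) (FF : Filter F) :
    H r @[r --> F] --> (0 : R) -> L' r @[r --> F] --> (0 : R).
  move=> HF; rewrite -(@sqrtr0 R) -[X in Num.sqrt X](mulr0 (6 * C)).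
  apply: continuous_cvg; first exact: sqrt_continuous.
  exact: cvgMl_tmp.
exists L', L', D; split; first by split; split=> //; exact: L'0.
move=> t x tx; rewrite normc_real lecR /admissible_weight/=.
rewrite -expr2 sqr_sqrtr ?mulr_ge0 ?H0 ?(ltW C0)//.
apply: (compact_CZ_bound _ _ _ _ _ _ _ (ltW d0) (ltW C0) Lb Sb Db KF K0).
by apply/eqP => txE; apply: tx.
Qed.
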